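(* Let $G$ be a theta-free and prism-free graph and let $W=(H,c)$ be a special wheel in $G$ whose two long sectors each have length at least three. Let $a'',b''\in V(G)\setminus N[Z(W)]$ belong to the interiors of two distinct sectors of $W$. Then $N[Z(W)]$ separates $a''$ and $b''$ in $G$.
   Context: Graphs are finite and simple. A path in $G$ is an induced subgraph that is a path; its interior is its set of non-end vertices; a hole is an induced cycle of length at least four. A theta is a graph consisting of two non-adjacent vertices $a,b$ and three pairwise internally disjoint paths from $a$ to $b$, each of length at least two, whose interiors are pairwise anticomplete. A prism is a graph consisting of two triangles $\{a_1,a_2,a_3\}$, $\{b_1,b_2,b_3\}$ and three pairwise disjoint paths $P_1,P_2,P_3$, where $P_i$ has ends $a_i,b_i$ (length zero allowed), such that for distinct $i,j$ the only edges between $P_i$ and $P_j$ are $a_ia_j$ and $b_ib_j$, and $P_i\cup P_j$ induces a hole. Theta-free/prism-free means no induced subgraph isomorphic to a theta/prism. A wheel in $G$ is a pair $W=(H,c)$ where $H$ is a hole and $c\notin V(H)$ has at least three neighbors in $H$. A sector of $W$ is a path of non-zero length in $H$ whose ends are adjacent to $c$ and whose interior vertices are not. $W$ is special if it has exactly three sectors, one of length one (with vertices $a,b$) and the other two, called long sectors, of length at least two. For a special wheel, let $d$ be the neighbor of $c$ in $H\setminus\{a,b\}$; then $Z(W)=\{a,b,c\}\cup N_H[d]$, where $N_H[d]$ is $d$ together with its neighbors in $H$. For $X\subseteq V(G)$, $N[X]$ is $X$ together with all vertices having a neighbor in $X$. A separation of $G$ is a triple $(L,M,R)$ of pairwise disjoint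 sets with union $V(G)$, $L,R$ non-empty and no edges between $L$ and $R$; $M\subseteq V(G)\setminus\{x,y\}$ separates $x$ and $y$ if there is a separation $(L,M,R)$ with $x\in L$, $y\in R$. *)

(* Defs.v *)
From mathcomp Require Import all_boot.

Set Implicit Arguments.
Unset Strict Implicit.
Unset Printing Implicit Defensive.

(* A finite simple graph is a symmetric irreflexive relation [e] on a finType
   [T].  Induced subgraphs (paths, holes, sectors, ...) are identified with
   their vertex sets. *)

Section Graphs.

Variables (T : finType) (e : rel T).
Implicit Types (S P H M L R X Y : {set T}) (a b c d x y : T).

(* [P] induces a path with ends [x] and [y] (the path of length zero has
   [x = y]). *)
Definition induced_path P x y : Prop :=
  exists p : seq T,
    [/\ P = [set v in x :: p], last x p = y, uniq (x :: p) &
        {in x :: p &, forall u v,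
          e u v = (index v (x :: p) == (index u (x :: p)).+1)
               || (index u (x :: p) == (index v (x :: p)).+1)}].

Definition path_length P : nat := #|P|.-1.

Definition interior P x y : {set T} := P :\: [set x; y].

Definition hole H : Prop :=
  exists h : seq T,
    [/\ H = [set v in h], uniq h, 4 <= size h &
        {in h &, forall u v, e u v = (v == next h u) || (u == next h v)}].

Definition anticomplete X Y : Prop := {in X & Y, forall x y, ~~ e x y}.

(* The subgraph induced by [S] is a theta. *)
Definition theta S : Prop :=
  exists a b (P : 'I_3 -> {set T}),
    [/\ a != b, ~~ e a b,
        S = \bigcup_i P i,
        forall i, induced_path (P i) a b /\ 2 <= path_length (P i) &
        forall i j, i != j ->
          [disjoint interior (P i) a b & interior (P j) a b] /\
          anticomplete (interior (P i) a b) (interior (P j) a b)].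

(* The subgraph induced by [S] is a prism. *)
Definition prism S : Prop :=
  exists (a b : 'I_3 -> T) (P : 'I_3 -> {set T}),
    [/\ S = \bigcup_i P i,
        forall i j, i != j -> e (a i) (a j) /\ e (b i) (b j),
        forall i, induced_path (P i) (a i) (b i) &
        forall i j, i != j ->
          [/\ [disjoint P i & P j],
              {in P i & P j, forall x y,
                e x y <-> (x = a i /\ y = a j) \/ (x = b i /\ y = b j)} &
              hole (P i :|: P j)]].

Definition theta_free : Prop := forall S, ~ theta S.
Definition prism_free : Prop := forall S, ~ prism S.

Definition wheel H c : Prop :=
  [/\ hole H, c \notin H & 3 <= #|[set v in H | e c v]|].

(* [S] is a sector of the wheel [(H, c)], with ends [x] and [y]. *)
Definition sector_with_ends H c S x y : Prop :=
  [/\ S \subset H, induced_path S x y, 0 < path_length S, e c x && e c y &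
      {in interior S x y, forall v, ~~ e c v}].

Definition sector H c S : Prop := exists x y, sector_with_ends H c S x y.

(* [(H, c)] is a special wheel, with short sector [[set a; b]] and long sectors
   [S1] and [S2]. *)
Definition special_wheel H c a b S1 S2 : Prop :=
  [/\ wheel H c,
      uniq [:: [set a; b]; S1; S2],
      forall S, sector H c S <-> S \in [:: [set a; b]; S1; S2],
      path_length [set a; b] = 1 &
      2 <= path_length S1 /\ 2 <= path_length S2].

(* Closed neighborhood of [X]. *)
Definition cnbh X : {set T} := [set v | (v \in X) || [exists u in X, e v u]].

(* [Z(W)] for the special wheel [W = (H, c)] with short sector [[set a; b]] and
   [d] the neighbor of [c] in [H :\: [set a; b]]. *)
Definition Zset H c a b d : {set T} :=
  [set a; b; c] :|: [set v in H | (v == d) || e d v].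

Definition separation L M R : Prop :=
  [/\ [/\ [disjoint L & M], [disjoint L & R] & [disjoint M & R]],
      L :|: M :|: R = [set: T],
      L != set0, R != set0 &
      anticomplete L R].

Definition separates M x y : Prop :=
  [/\ x \notin M, y \notin M &
      exists L R, [/\ separation L M R, x \in L & y \in R]].

End Graphs.

(* Main.v *)
(* Write H as the path a A d B b closed by the edge ab.  If N[Z(W)] does not
   separate a'' from b'', there is an induced path Q = v ... w outside N[Z(W)]
   and H such that only v has neighbors in A and only w has neighbors in B.
   - If w has two non-adjacent neighbors in B, let y and y' be those nearest to
     b and d, and x' the neighbor of v nearest to d: then d and w are the ends of
     a theta with paths d..x' Q, d..y' w and d c b..y w.
   - If w has exactly two neighbors y, y' in B and they are adjacent, let x be
     the neighbor of v nearest to a: the triangles w y y' and a b c form a prism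
     with paths Q x..a, y..b and y'..d c (x is not adjacent to d, since v avoids
     N[N_H[d]]).
   So w has a unique neighbor y in B, and by symmetry v a unique neighbor x in
   A; then H and Q form a theta with ends x and y. *)
Require Import Defs.
From mathcomp Require Import all_boot.

Set Implicit Arguments.
Unset Strict Implicit.
Unset Printing Implicit Defensive.

(** * Induced paths as vertex sequences *)

Section InducedPaths.

Variables (T : finType) (e : rel T).
Hypotheses (e_sym : symmetric e) (e_irr : irreflexive e).
Implicit Types (s t p q A B : seq T) (S H : {set T}).

(** Distinctness is bundled with non-adjacency so that a single [all] or [allrel] condition
    expresses both disjointness and anticompleteness. *)
Definition apart : rel T := fun x y => (x != y) && ~~ e x y.

Lemma apartC : symmetric apart.
Proof. by move=> x y; rewrite /apart eq_sym e_sym. Qed.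

Lemma allrel_apartC s t : allrel apart s t = allrel apart t s.
Proof. by rewrite allrelC; apply: eq_allrel => x y; rewrite apartC. Qed.

Lemma allrel_apart_consr x s t :
  allrel apart s (x :: t) = all (apart x) s && allrel apart s t.
Proof. by rewrite allrel_consr; congr (_ && _); apply: eq_all => y; apply: apartC. Qed.

(** A recursive boolean test, so that concrete concatenations split by rewriting into elementary
    adjacency and apartness facts. The empty sequence passes. *)
Fixpoint ipath s : bool :=
  if s is x :: s' then
    (if s' is y :: t then e x y && all (apart x) t else true) && ipath s'
  else true.

Lemma ipath1 x : ipath [:: x]. Proof. by []. Qed.

Lemma ipath_cons2 x y s :
  ipath [:: x, y & s] = [&& e x y, all (apart x) s & ipath (y :: s)].
Proof. by rewrite andbA. Qed.

(** Both pieces contain the shared vertex [x], so every pair of vertices lies in one piece except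
    those between [s] and [t]; these must be apart. *)
Lemma ipath_cat s x t :
  ipath (s ++ x :: t) =
  [&& ipath (rcons s x), ipath (x :: t) & allrel apart s t].
Proof.
elim: s => [|y [|z s] IH]; first by rewrite allrel0l andbT.
  by rewrite ipath_cons2 allrel1l !ipath_cons2 /=; case: (e y x); rewrite //= andbC.
rewrite !cat_cons ipath_cons2 -cat_cons IH [allrel _ [:: y, z & s] _]allrel_consl.
rewrite !rcons_cons ipath_cons2 all_cat all_rcons [all _ (x :: t)]/=.
by rewrite -!andbA; do !bool_congr.
Qed.

Lemma ipath_cons_cat x s y t :
  ipath (x :: s ++ y :: t) =
  [&& ipath (x :: rcons s y), ipath (y :: t), all (apart x) t & allrel apart s t].
Proof. by rewrite -cat_cons ipath_cat allrel_consl. Qed.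

Lemma ipath_rev s : ipath (rev s) = ipath s.
Proof.
elim: s => [|x [|y s] IH] //.
rewrite ipath_cons2 -IH !rev_cons -[rcons (rcons _ y) x]cats1 cat_rcons.
rewrite ipath_cat ipath_cons2 andbT allrel1r all_rev e_sym /=.
rewrite (eq_all (a2 := apart x)); last by move=> z; rewrite apartC.
by case: (e _ _); rewrite /= ?andbF //= andbC.
Qed.

Lemma ipath_cons_rev x s : ipath (x :: rev s) = ipath (rcons s x).
Proof. by rewrite -rev_rcons ipath_rev. Qed.

Lemma ipath_rcons_rev x s : ipath (rcons (rev s) x) = ipath (x :: s).
Proof. by rewrite -rev_cons ipath_rev. Qed.

Lemma ipath_cons_rcons_rev x s y :
  ipath (x :: rcons (rev s) y) = ipath (y :: rcons s x).
Proof. by rewrite -rev_cons -rev_rcons ipath_rev. Qed.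

Lemma ipath_notin x s : ipath (x :: s) -> x \notin s.
Proof.
case: s => // y s; rewrite ipath_cons2 inE negb_or => /and3P [exy /allP xs _].
apply/andP; split; first by apply: contraTneq exy => ->; rewrite e_irr.
by apply/negP => /xs; rewrite /apart eqxx.
Qed.

Lemma ipath_cons x s : ipath (x :: s) -> ipath s.
Proof. by case/andP. Qed.

Lemma ipath_uniq s : ipath s -> uniq s.
Proof. by elim: s => //= x s IH xs; rewrite ipath_notin // IH //; case/andP: xs. Qed.

Lemma ipath_catr s t : ipath (s ++ t) -> ipath t.
Proof. by elim: s => // x s IH /ipath_cons. Qed.

Lemma ipath_head x s y : ipath (x :: s) -> y \in s -> e x y = (y == head x s).
Proof.
case: s => // z s; rewrite ipath_cons2 inE /= => /and3P [exz /allP xs zs].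
case: eqP => [-> //|_ /= /[dup] ys /xs /andP[_ /negbTE]] //.
Qed.

Definition consecutive s u v :=
  (index v s == (index u s).+1) || (index u s == (index v s).+1).

Lemma consecutive_cons x s u v :
  x != u -> x != v -> consecutive (x :: s) u v = consecutive s u v.
Proof. by rewrite /consecutive /= => /negbTE -> /negbTE ->; rewrite !eqSS. Qed.

Lemma consecutive_head x s v :
  x \notin s -> v \in s -> consecutive (x :: s) x v = (v == head x s).
Proof.
move=> xs vs; rewrite /consecutive /= eqxx orbF.
case: (eqVneq x v) => [xv|_]; first by rewrite xv vs in xs.
by rewrite eqSS; case: s vs {xs} => //= y s _; rewrite [v == y]eq_sym; case: (y == v).
Qed.

Lemma consecutiveC s u v : consecutive s u v = consecutive s v u.
Proof. by rewrite /consecutive orbC. Qed.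

Lemma consecutive_irr s u : consecutive s u u = false.
Proof. by rewrite /consecutive eq_sym orbb; rewrite gtn_eqF. Qed.

(** Bridge from the recursive test to the index-based adjacency condition in [induced_path]. *)
Lemma ipathP s :
  ipath s <-> uniq s /\ {in s &, forall u v, e u v = consecutive s u v}.
Proof.
split=> [ips|].
  split; first exact: ipath_uniq.
  elim: s ips => // x s IH ips u v.
  have xs := ipath_notin ips; rewrite !inE.
  case: (eqVneq u x) => [->|ux]; case: (eqVneq v x) => [->|vx] //=.
  - by rewrite consecutive_irr e_irr.
  - by move=> _ vs; rewrite consecutive_head // (ipath_head ips).
  - by move=> us _; rewrite consecutiveC e_sym consecutive_head // (ipath_head ips).
  by move=> us vs; rewrite consecutive_cons 1?eq_sym // (IH (ipath_cons ips)) //.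
elim: s => // x s IH [] /andP [xs us] C /=.
have nx u : u \in s -> x != u by apply: contraTneq => <-.
apply/andP; split; last first.
  apply: IH; split=> // u v uin vin.
  by rewrite C ?inE ?uin ?vin ?orbT // consecutive_cons ?nx.
case: s IH xs us C nx => // y s _ xs /andP [ys us] C nx.
rewrite C ?inE ?eqxx ?orbT // consecutive_head ?inE ?eqxx //=.
apply/allP => z zs; rewrite /apart nx ?inE ?zs ?orbT //.
rewrite C ?inE ?eqxx ?zs ?orbT // consecutive_head ?inE ?zs ?orbT //=.
by apply: contraNneq ys => <-.
Qed.

Arguments ipath : simpl never.

Lemma ipath_induced x p :
  ipath (x :: p) -> induced_path e [set z in x :: p] x (last x p).
Proof. by case/ipathP=> u C; exists p. Qed.

Lemma path_length_seq x p :
  uniq (x :: p) -> path_length [set z in x :: p] = size p.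
Proof. by move=> u; rewrite /path_length cardsE (card_uniqP u). Qed.

(** * Holes cut open at a vertex *)

Lemma next_consecutive x p u v :
  uniq (x :: p) -> u \in x :: p -> v \in x :: p ->
  (v == next (x :: p) u) =
  (index v (x :: p) == (index u (x :: p)).+1) || (v == x) && (u == last x p).
Proof.
move=> U uin vin; rewrite next_nth uin.
have iu : index u (x :: p) < (size p).+1 by rewrite -index_mem in uin.
have iv : index v (x :: p) < (size p).+1 by rewrite -index_mem in vin.
have ul : (u == last x p) = (index u (x :: p) == size p).
  have -> : last x p = nth x (x :: p) (size p) by rewrite nth_last.
  rewrite -{1}(nth_index x uin) nth_uniq //=.
rewrite ul; case: (ltngtP (index u (x :: p)) (size p)) => [lt|gt|eq].
- rewrite andbF orbF -[nth x p _]/(nth x (x :: p) (index u (x :: p)).+1).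
  by rewrite -{1}(nth_index x vin) nth_uniq //=.
- by rewrite ltnS leqNgt gt in iu.
(* For the last vertex, [nth] runs off the end of [p] and returns its default [x]: this is the
   wrap-around of the cycle. *)
rewrite eq nth_default // andbT [index v _ == _]ltn_eqF //.
Qed.

(** An induced cycle cut at [x]: the rest is an induced path, and [x] sees exactly its two ends. The
    bound on [size p] says that the cycle has length at least four. *)
Definition icycle x p :=
  [&& x \notin p, ipath p, 2 < size p &
    all (fun v => e x v == (v == head x p) || (v == last x p)) p].

(** Cyclic adjacency is path adjacency plus the pair closing the cycle. That pair involves [x], so
    on [p] only the path adjacency remains. *)
Lemma next_rel_icycle x p : uniq (x :: p) -> 2 < size p ->
  {in x :: p &, forall u v,
    e u v = (v == next (x :: p) u) || (u == next (x :: p) v)} <-> icycle x p.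
Proof.
move=> U sz; have /andP [xp Up] := U.
have nx u : u \in p -> (u == x) = false by move=> up; apply: contraNF xp => /eqP <-.
have key u v : u \in x :: p -> v \in x :: p ->
    (v == next (x :: p) u) || (u == next (x :: p) v) =
    [|| consecutive (x :: p) u v, (v == x) && (u == last x p)
      | (u == x) && (v == last x p)].
  move=> uin vin; rewrite !next_consecutive // /consecutive.
  by rewrite -!orbA; do !bool_congr.
have keyp u v : u \in p -> v \in p ->
    (v == next (x :: p) u) || (u == next (x :: p) v) = consecutive p u v.
  move=> up vp; rewrite key ?inE ?up ?vp ?orbT // !nx //= orbF.
  by rewrite consecutive_cons // eq_sym nx.
have keyx v : v \in p ->
    (v == next (x :: p) x) || (x == next (x :: p) v) = (v == head x p) || (v == last x p).
  by move=> vp; rewrite key ?inE ?eqxx ?vp ?orbT // consecutive_head // nx.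
split=> [C|].
  apply/and4P; split=> //.
    apply/ipathP; split=> // u v up vp.
    by rewrite C ?inE ?up ?vp ?orbT // keyp.
  by apply/allP => v vp; rewrite C ?inE ?eqxx ?vp ?orbT // keyx.
case/and4P=> _ /ipathP [_ C] _ /allP X u v; rewrite !inE.
case: (eqVneq u x) => [->|ux]; case: (eqVneq v x) => [->|vx] //=.
- rewrite e_irr key ?inE ?eqxx // consecutive_irr ?eqxx /= orbb => _ _.
  apply/esym/negbTE; apply: contra xp => /eqP {1}->.
  by case: (p) sz => // y s _; rewrite [last _ _]/= mem_last.
- by move=> _ vp; rewrite keyx //; exact/eqP/X.
- by move=> up _; rewrite e_sym orbC keyx //; exact/eqP/X.
by move=> up vp; rewrite keyp // C.
Qed.

Lemma icycle_uniq x p : icycle x p -> uniq (x :: p).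
Proof. by case/and4P=> xp /ipath_uniq up _ _; rewrite /= xp. Qed.

Lemma icycle_hole x p : icycle x p -> hole e [set z in x :: p].
Proof.
move=> /[dup] /icycle_uniq U /[dup] /and4P [_ _ sz _] icp; exists (x :: p).
by split=> //; apply/next_rel_icycle.
Qed.

(** * Thetas and prisms assembled from three sequences *)

Lemma theta_of_paths (x y : T) (s : 'I_3 -> seq T) :
  (forall i, s i != [::]) -> (forall i, ipath (x :: s i ++ [:: y])) ->
  (forall i j, i != j -> allrel apart (s i) (s j)) -> exists S, theta e S.
Proof.
move=> sn0 ips far.
have inter i : interior [set z in x :: s i ++ [:: y]] x y = [set z in s i].
  have /ipath_uniq := ips i; rewrite cons_uniq cat_uniq mem_cat /= orbF andbT.
  rewrite negb_or => /andP [/andP [xs xy] /andP [_ ys]].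
  apply/setP => z; rewrite !inE mem_cat inE.
  case: (eqVneq z x) => [->|_] /=; first by rewrite (negbTE xs).
  by case: (eqVneq z y) => [->|_]; rewrite ?(negbTE ys) ?orbF.
(* One path suffices to see that the ends are distinct and non-adjacent, since its interior is
   non-empty. *)
have /andP [xy xy'] : apart x y.
  case E: (s ord0) (sn0 ord0) (ips ord0) => [//|z t] _; rewrite cat_cons ipath_cons2.
  by rewrite all_cat /= andbT => /and3P [_ /andP [_ ->]].
exists (\bigcup_i [set z in x :: s i ++ [:: y]]), x, y,
  (fun i => [set z in x :: s i ++ [:: y]]); split=> // [i|i j ij].
  split; first by have := ipath_induced (ips i); rewrite last_cat.
  rewrite path_length_seq ?(ipath_uniq (ips i)) // size_cat addn1 ltnS.
  by rewrite lt0n size_eq0.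
rewrite !inter; have /allrelP f := far i j ij; split.
  rewrite disjoint_subset; apply/subsetP => z; rewrite !inE => zi.
  by apply/negP => /(f _ _ zi); rewrite /apart eqxx.
by move=> u v; rewrite !inE => ui vj; case/andP: (f _ _ ui vj).
Qed.

Lemma theta_of_three_paths x y s1 s2 s3 :
  [&& s1 != [::], s2 != [::] & s3 != [::]] ->
  [&& ipath (x :: s1 ++ [:: y]), ipath (x :: s2 ++ [:: y]) & ipath (x :: s3 ++ [:: y])] ->
  [&& allrel apart s1 s2, allrel apart s1 s3 & allrel apart s2 s3] ->
  exists S, theta e S.
Proof.
move=> /and3P [n1 n2 n3] /and3P [p1 p2 p3] /and3P [f12 f13 f23].
by apply: (@theta_of_paths x y (fun i => nth [::] [:: s1; s2; s3] i));
  do ?[case=> [[|[|[|]]] ?] //]; rewrite allrel_apartC.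
Qed.

(* The only edges between the paths a s b and a' s' b' are aa' and bb'. *)
Definition linked (a : T) s (b a' : T) s' (b' : T) :=
  [&& e a a', e b b', apart a b' & apart b a'] &&
  [&& all (apart a) s', all (apart b) s', all (apart a') s, all (apart b') s
    & allrel apart s s'].

Lemma linkedC a s b a' s' b' : linked a s b a' s' b' -> linked a' s' b' a s b.
Proof.
case/andP=> /and4P [aa bb ab ba] /and5P [as' bs' a's b's ss].
by rewrite /linked (e_sym a') aa e_sym bb apartC ba apartC ab a's b's as' bs' allrel_apartC.
Qed.

Lemma linkedP a s b a' s' b' : linked a s b a' s' b' ->
  {in a :: s ++ [:: b] & a' :: s' ++ [:: b'], forall x y,
    [\/ apart x y, x = a /\ y = a' | x = b /\ y = b']}.
Proof.
case/andP=> /and4P [eaa ebb ab ba] /and5P [/allP as' /allP bs' /allP a's /allP b's].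
move=> /allrelP ss x y; rewrite !inE !mem_cat !mem_seq1.
case/or3P=> [/eqP->|xs|/eqP->]; case/or3P=> [/eqP->|ys|/eqP->];
  by [constructor 2 | constructor 3 | constructor 1; do ?[by auto]; rewrite apartC; auto].
Qed.

Lemma linked_disjoint a s b a' s' b' : linked a s b a' s' b' ->
  {in a :: s ++ [:: b] & a' :: s' ++ [:: b'], forall x y, x != y}.
Proof.
move=> /[dup] l /linkedP lP x y xs ys; have [/andP [] //|[-> ->]|[-> ->]] := lP x y xs ys;
by case/andP: l => /and4P [eaa ebb _ _] _; apply/eqP => E; rewrite ?E e_irr in eaa ebb.
Qed.

Lemma linked_edge a s b a' s' b' : linked a s b a' s' b' ->
  {in a :: s ++ [:: b] & a' :: s' ++ [:: b'], forall x y,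
    e x y <-> (x = a /\ y = a') \/ (x = b /\ y = b')}.
Proof.
move=> /[dup] l /linkedP lP x y xs ys; split=> [xy|].
  have [/andP [_]|E|E] := lP x y xs ys; [by rewrite xy | by left | by right].
by case/andP: l => /and4P [eaa ebb _ _] _ [[-> ->]|[-> ->]].
Qed.

(** Run along the first path from [a] to [b], cross to [b'], and return along the second path
    reversed. Cut at [a], this cycle closes through the edge from [a'] to [a]. *)
Lemma linked_hole a s b a' s' b' :
  ipath (a :: s ++ [:: b]) -> ipath (a' :: s' ++ [:: b']) ->
  linked a s b a' s' b' ->
  hole e ([set z in a :: s ++ [:: b]] :|: [set z in a' :: s' ++ [:: b']]).
Proof.
move=> p p' l.
have -> : [set z in a :: s ++ [:: b]] :|: [set z in a' :: s' ++ [:: b']] =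
    [set z in a :: s ++ b :: b' :: rev s' ++ [:: a']].
  apply/setP => z; rewrite !inE !(mem_cat, inE, mem_rev) -!orbA; do !bool_congr.
have asb : a \notin s ++ [:: b] by apply: ipath_notin p.
have dis := linked_disjoint l; have edg := linked_edge l.
have sz : 2 < size (s ++ b :: b' :: rev s' ++ [:: a']).
  by rewrite size_cat /= size_cat /= addn1 !addnS.
apply: icycle_hole; apply/and4P; split=> //.
- apply/negP; rewrite -[_ :: _]/([:: b] ++ _) catA mem_cat (negbTE asb) /= => ain.
  have {}ain : a \in a' :: s' ++ [:: b'].
    move: ain; rewrite !(mem_cat, inE, mem_rev).
    by case/or3P => ->; rewrite ?orbT.
  by have := dis a a (mem_head _ _) ain; rewrite eqxx.
- have /andP [/and4P [eaa ebb ab ba] /and5P [as' bs' a's b's ss]] := l.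
  have p2 : ipath (b' :: rev s' ++ [:: a']) by rewrite cats1 ipath_cons_rcons_rev -cats1.
  rewrite ipath_cat -cats1 (ipath_cons p) ipath_cons2 ebb p2 all_cat all_rev bs'.
  rewrite allrel_apart_consr allrel_catr allrel_revr ss b's allrel_apart_consr a's.
  by rewrite allrel0r [all _ [:: a']]/= ba.
have hd : head a (s ++ b :: b' :: rev s' ++ [:: a']) = head a (s ++ [:: b]) by case: (s).
have hin : head a (s ++ [:: b]) \in a :: s ++ [:: b].
  by case: (s) => [|z t]; rewrite /= !inE eqxx ?orbT.
have lst : last a (s ++ b :: b' :: rev s' ++ [:: a']) = a'.
  by rewrite last_cat /= last_cat.
apply/allP => v; rewrite hd lst -[_ :: _]/([:: b] ++ _) catA mem_cat => /orP [vs|vs'].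
  rewrite (ipath_head p vs); case: (eqVneq v a') => [E|]; last by rewrite orbF.
  have := dis v a'; rewrite !inE eqxx vs orbT E eqxx => /(_ isT isT) //.
have {}vs' : v \in a' :: s' ++ [:: b'].
  by move: vs'; rewrite !inE !mem_cat mem_rev !inE => /or3P [] ->; rewrite ?orbT.
have -> : (v == head a (s ++ [:: b])) = false.
  by apply/negbTE; rewrite eq_sym; apply: dis.
rewrite /=; apply/eqP; apply/idP/eqP => [av|->].
  have [[] //|[E _]] := proj1 (edg a v (mem_head _ _) vs') av.
  by rewrite E mem_cat inE eqxx orbT in asb.
by case/andP: l => /and4P [].
Qed.

Lemma prism_of_paths (a b : 'I_3 -> T) (s : 'I_3 -> seq T) :
  (forall i, ipath (a i :: s i ++ [:: b i])) ->
  (forall i j, i != j -> linked (a i) (s i) (b i) (a j) (s j) (b j)) ->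
  exists S, prism e S.
Proof.
move=> ips L; pose P i := [set z in a i :: s i ++ [:: b i]].
exists (\bigcup_i P i), a, b, P; split=> // [i j ij|i|i j ij].
- by case/andP: (L i j ij) => /and4P [].
- by have := ipath_induced (ips i); rewrite last_cat.
have l := L i j ij; split.
- rewrite disjoint_subset; apply/subsetP => z; rewrite in_set => zi.
  apply/negP; rewrite /= in_set => zj.
  by have := linked_disjoint l zi zj; rewrite eqxx.
- by move=> x y; rewrite !in_set; apply: linked_edge.
exact: linked_hole.
Qed.

Lemma prism_of_three_paths a1 s1 b1 a2 s2 b2 a3 s3 b3 :
  [&& ipath (a1 :: s1 ++ [:: b1]), ipath (a2 :: s2 ++ [:: b2])
    & ipath (a3 :: s3 ++ [:: b3])] ->
  [&& linked a1 s1 b1 a2 s2 b2, linked a1 s1 b1 a3 s3 b3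
    & linked a2 s2 b2 a3 s3 b3] ->
  exists S, prism e S.
Proof.
move=> /and3P [p1 p2 p3] /and3P [l12 l13 l23].
by apply: (@prism_of_paths (fun i => nth a1 [:: a1; a2; a3] i)
  (fun i => nth a1 [:: b1; b2; b3] i) (fun i => nth [::] [:: s1; s2; s3] i));
  do ?[case=> [[|[|[|]]] ?] //] => _; apply: linkedC.
Qed.

(** * Paths crossing between the two long sectors *)

(* The hole a A d (rev B) b with hub c: [A] and [B] are the interiors of the long
   sectors, listed from [a] and from [b] towards [d]. *)
Record tripod (a : T) A (b : T) B (c d : T) : Prop := Tripod {
  tripod_A : ipath (a :: A ++ [:: d]);
  tripod_B : ipath (b :: B ++ [:: d]);
  tripod_ab : e a b;
  tripod_aB : all (apart a) B;
  tripod_bA : all (apart b) A;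
  tripod_AB : allrel apart A B;
  tripod_c : [&& e c a, e c b & e c d];
  tripod_cA : all (apart c) A;
  tripod_cB : all (apart c) B }.

Lemma tripodC a A b B c d : tripod a A b B c d -> tripod b B a A c d.
Proof.
case=> hA hB ab aB bA AB /and3P [ca cb cd] cA cB; split=> //.
- by rewrite e_sym.
- by rewrite allrel_apartC.
- by rewrite ca cb cd.
Qed.

(* The path [v :: q = rcons q' w] is duplicated in the parameters so that the
   record is symmetric under reversal. *)
Record crossing (a : T) A (b : T) B (c d v : T) q q' (w : T) : Prop := Crossing {
  crossing_wheel : tripod a A b B c d;
  crossing_Q : ipath (v :: q);
  crossing_vq : v :: q = rcons q' w;
  crossing_aQ : all (apart a) (v :: q);
  crossing_bQ : all (apart b) (v :: q);
  crossing_cQ : all (apart c) (v :: q);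
  crossing_dQ : all (apart d) (v :: q);
  crossing_qA : allrel apart q A;
  crossing_q'B : allrel apart q' B;
  crossing_vA : v \notin A;
  crossing_wB : w \notin B;
  crossing_v : has (e v) A;
  crossing_w : has (e w) B;
  crossing_vd : {in A, forall z, e v z -> apart z d};
  crossing_wd : {in B, forall z, e w z -> apart z d} }.

Lemma crossingC a A b B c d v q q' w :
  crossing a A b B c d v q q' w -> crossing b B a A c d w (rev q') (rev q) v.
Proof.
case=> /tripodC tr Q vq aQ bQ cQ dQ qA q'B vA wB hv hw vd wd.
have E : w :: rev q' = rev (v :: q) by rewrite vq rev_rcons.
by split; rewrite ?E ?all_rev ?ipath_rev ?allrel_revl // rev_cons.
Qed.

Lemma first_neighbor v A : v \notin A -> has (e v) A ->
  exists A1 x A2, [/\ A = A1 ++ x :: A2, e v x & all (apart v) A1].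
Proof.
move=> vA /split_find hA; case: hA vA => x A1 A2 vx nA1; rewrite cat_rcons => vA.
exists A1, x, A2; split=> //; apply/allP => z zA.
apply/andP; split; first by apply: contraNneq vA => ->; rewrite mem_cat zA.
by apply: contra nA1 => vz; apply/hasP; exists z.
Qed.

Lemma last_neighbor v A : v \notin A -> has (e v) A ->
  exists A1 x A2, [/\ A = A1 ++ x :: A2, e v x & all (apart v) A2].
Proof.
rewrite -mem_rev -has_rev => /first_neighbor /[apply] - [A1 [x [A2 [E vx n]]]].
exists (rev A2), x, (rev A1); rewrite all_rev; split=> //.
by rewrite -(revK A) E rev_cat rev_cons cat_rcons.
Qed.

Lemma all_nil (P : pred T) : all P [::] = true. Proof. by []. Qed.

Lemma all_cons (P : pred T) x s : all P (x :: s) = P x && all P s.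
Proof. by []. Qed.

Definition apart_rules :=
  (all_cat, all_rev, all_rcons, all_cons, all_nil, @allrel_catl T T,
   @allrel_catr T T, @allrel_consl T T, allrel_apart_consr, @allrel_revl T T,
   @allrel_revr T T, @allrel0l T T, @allrel0r T T).

Definition ipath_rules :=
  (rcons_cat, rcons_cons, ipath_cons2, ipath_cons_cat, ipath_cat, ipath_cons_rcons_rev,
   ipath_cons_rev, ipath_rcons_rev, ipath1).

(** Breaks all path and apartness hypotheses at their concatenations into atomic facts; [path_solve]
    does the same to the goal and looks each atom up, modulo symmetry. *)
Ltac path_split :=
  repeat match goal with H : is_true _ |- _ =>
    let P := type of H in
    rewrite -?catA ?cat_cons ?ipath_rules ?apart_rules /= ?andbT in H;
    let P' := type of H in tryif constr_eq P P' then fail else idtac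
  end;
  repeat match goal with H : is_true (_ && _) |- _ => 
    let H1 := fresh "F" in let H2 := fresh "F" in case/andP: H => H1 H2 end.

Ltac path_solve :=
  rewrite -?catA ?cat_cons ?ipath_rules ?apart_rules /=;
  repeat match goal with |- is_true (_ && _) => apply/andP; split end;
  first [done | rewrite apartC; done | rewrite e_sym; done
        | rewrite allrel_apartC; done | idtac].

Lemma crossing_neighbor a A b B c d v q q' w :
  theta_free e -> prism_free e -> crossing a A b B c d v q q' w ->
  exists B1 y B2, [/\ B = B1 ++ y :: B2, e w y & all (apart w) (B1 ++ B2)].
Proof.
move=> TF PF [] [] hA hB ab aB bA AB /and3P [ca cb cd] cA cB Q vq aQ bQ cQ dQ.
move=> qA q'B vA wB hv hw vd wd.
have [B1 [y [B2 [EB wy wB1]]]] := first_neighbor wB hw.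
case hB2: (has (e w) B2); last first.
  exists B1, y, B2; split=> //; rewrite all_cat wB1 /=.
  apply/allP => z zB; apply/andP; split; last by apply: contraFN hB2 => wz; apply/hasP; exists z.
  by apply: contraNneq wB => ->; rewrite EB mem_cat inE zB !orbT.
have wB2 : w \notin B2 by apply: contra wB; rewrite EB mem_cat inE => ->; rewrite !orbT.
have [B3 [y' [B4 [EB2 wy' wB4]]]] := last_neighbor wB2 hB2.
have wdy' := wd y'; have {}wd := wd y.
subst B2 B.
(* Because [v :: q = rcons q' w], what is known about [v] and [q] turns into facts about [q'] and
   [w], the form in which the paths ending at [w] are built. *)
have hsplit A' x : e v x -> all (apart x) q -> allrel apart q A' -> all (apart v) A' ->
   [&& ipath (x :: rcons q' w), allrel apart q' A' & all (apart w) A'].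
  move=> vx xq qA' vA'; rewrite -vq ipath_cons2 e_sym vx xq Q /=.
  have : allrel apart (v :: q) A' by rewrite allrel_consl vA'.
  by rewrite vq -cats1 allrel_catl allrel_consl allrel0l andbT.
have {}aQ : all (apart a) (rcons q' w) by rewrite -vq.
have {}bQ : all (apart b) (rcons q' w) by rewrite -vq.
have {}cQ : all (apart c) (rcons q' w) by rewrite -vq.
have {}dQ : all (apart d) (rcons q' w) by rewrite -vq.
have {}Q : ipath (rcons q' w) by rewrite -vq.
(* [B3] is the part of [B] strictly between [y] and [y'], the neighbors of [w] nearest to [b] and to
   [d]. If it is empty they are adjacent and a prism arises; otherwise they are non-adjacent and a
   theta arises. *)
case: B3 => [|z B3] in wB2 hB2 hB aB AB cB q'B wB hw wd wdy' *.
  have [A1 [x [A2 [EA vx vA1]]]] := first_neighbor vA hv.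
  have {}vd := vd x; subst A.
  rewrite !mem_cat !inE !eqxx !orbT in wd wdy' vd.
  have {vd}xd := vd isT vx; have {wd}yd := wd isT wy.
  have {wdy'}y'd := wdy' isT wy'.
  suff [S /PF //] : exists S, prism e S.
  move: (qA); rewrite allrel_catr allrel_apart_consr => /and3P [qA1 xq _].
  have {hsplit} := hsplit A1 x vx xq qA1 vA1 => hs.
  clear hv hw wB hB2 wB2 PF TF; path_split.
  (* The first path goes back along Q to [x] and then along [A1] to [a]; [xd] keeps it apart from
     the vertex [d] of the third path. *)
  apply: (@prism_of_three_paths w (rev q' ++ x :: rev A1) a y (rev B1) b y' (B4 ++ [:: d]) c).
    path_solve.
  rewrite /linked; path_solve.
suff [S /TF //] : exists S, theta e S.
have [A3 [x' [A4 [EA vx' vA4]]]] := last_neighbor vA hv; subst A.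
move: (qA); rewrite allrel_catr allrel_apart_consr => /and3P [_ x'q qA4].
have {hsplit} := hsplit A4 x' vx' x'q qA4 vA4 => hs.
clear hv hw wB hB2 wB2 PF TF; path_split.
(* The three routes from [d] to [w]: through [A4] and Q, through [B4] to [y'], and through the hub
   [c] and [b] to [y]. *)
apply: (@theta_of_three_paths d w (rev A4 ++ x' :: q') (rev B4 ++ [:: y'])
  (c :: b :: B1 ++ [:: y])).
- by rewrite -!size_eq0 !size_cat /= !addnS.
- path_solve.
path_solve.
Qed.

Lemma no_crossing a A b B c d v q q' w :
  theta_free e -> prism_free e -> ~ crossing a A b B c d v q q' w.
Proof.
move=> TF PF cr.
have [B1 [y [B2 [EB wy wB]]]] := crossing_neighbor TF PF cr.
(* Reversing the crossing exchanges the two sides, so the same lemma gives the unique neighbor of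
   [v] in [A]. *)
have [A1 [x [A2 [EA vx vA]]]] := crossing_neighbor TF PF (crossingC cr).
case: cr => [] [] hA hB ab aB bA AB /and3P [ca cb cd] cA cB Q vq aQ bQ cQ dQ.
move=> qA q'B _ _ _ _ _ _; subst A B.
move: (qA); rewrite allrel_catr allrel_apart_consr => /and3P [qA1 xq qA2].
have {}aQ : all (apart a) (rcons q' w) by rewrite -vq.
have {}bQ : all (apart b) (rcons q' w) by rewrite -vq.
have {}dQ : all (apart d) (rcons q' w) by rewrite -vq.
have hx : ipath (x :: rcons q' w) by rewrite -vq ipath_cons2 e_sym vx xq.
have hAQ : allrel apart (rcons q' w) (A1 ++ A2).
  by rewrite -vq allrel_consl vA allrel_catr qA1 qA2.
rewrite -cats1 in hAQ.
have {}Q : ipath (rcons q' w) by rewrite -vq.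
suff [S /TF //] : exists S, theta e S.
path_split.
(* The path Q, the arc of the hole through the edge [a b], and the arc through [d]. *)
apply: (@theta_of_three_paths x y (q' ++ [:: w]) (rev A1 ++ a :: b :: B1) (A2 ++ d :: rev B2)).
- by rewrite -!size_eq0 !size_cat /= !addnS.
- path_solve.
path_solve.
Qed.

(** * Extracting induced paths from walks *)

Lemma last_split (X : pred T) s : has X s ->
  exists s1 z s2, [/\ s = s1 ++ z :: s2, X z & all (predC X) s2].
Proof.
rewrite -has_rev => /split_find hs; case E: _ _ _ / hs => [z s1 s2 Xz n].
exists (rev s2), z, (rev s1); split=> //; last by rewrite all_rev all_predC.
by rewrite -(revK s) E cat_rcons rev_cat rev_cons cat_rcons.
Qed.

Lemma last_suffix (v : T) q s1 z s2 : v :: q = s1 ++ z :: s2 ->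
  last v q = last z s2 /\ {subset belast z s2 <= belast v q}.
Proof.
case: s1 => [|u s1] [-> ->]; first by split.
rewrite last_cat belast_cat /= -cat_rcons -lastI.
by split=> // t; rewrite mem_cat => ->; rewrite orbT.
Qed.

(** Induction along the walk. Given the induced path for its tail: if [v] satisfies [Y], stop at
    [v]; if [v] already lies on the path, start there; otherwise prepend [v] to the suffix beginning
    at the last neighbor of [v], which has no other neighbor of [v]. *)
Lemma ipath_to (Y : pred T) v q : path e v q -> Y (last v q) ->
  exists q', [/\ ipath (v :: q'), {subset v :: q' <= v :: q}, Y (last v q')
    & all (predC Y) (belast v q')].
Proof.
elim: q v => [|w q IH] v /=; first by move=> _ Yv; exists [::]; split.
case/andP=> vw /IH /[apply] - [q' [ip sub Yl nY]].
case Yv: (Y v); first by exists [::]; split=> // z; rewrite !inE => ->.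
have sub' s : {subset s <= w :: q'} -> {subset v :: s <= [:: v, w & q]}.
  by move=> ss z; rewrite !in_cons => /orP [->//|/ss /sub]; rewrite in_cons => ->; rewrite orbT.
have suf s1 s2 : w :: q' = s1 ++ s2 -> {subset s2 <= w :: q'}.
  by move=> -> z zs; rewrite mem_cat zs orbT.
case: (boolP (v \in w :: q')) => [/splitPr hv|nv].
  case E: _ / hv => [s1 s2]; have [El Eb] := last_suffix E.
  exists s2; rewrite -El; split=> //.
  - by move: ip; rewrite E => /ipath_catr.
  - by apply: sub' => z zs; apply: (suf _ _ E); rewrite in_cons zs orbT.
  by apply/allP => z /Eb; apply: (allP nY).
have [|s1 [z [s2 [E vz nz]]]] := @last_split (e v) (w :: q'); first by rewrite /= vw.
have [El Eb] := last_suffix E.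
have ssub := suf _ _ E.
exists (z :: s2); split=> /=.
- rewrite ipath_cons2 vz; apply/andP; split=> //; apply/andP; split.
    apply/allP => t ts; apply/andP; split; last exact: (allP nz).
    by apply: contraNneq nv => ->; apply: ssub; rewrite in_cons ts orbT.
  by move: ip; rewrite E => /ipath_catr.
- exact: sub'.
- by rewrite -El.
by rewrite Yv; apply/allP => t /Eb; apply: (allP nY).
Qed.

(** Stop at the first [Y]-vertex by [ipath_to], then keep the suffix from the last [X]-vertex. *)
Lemma ipath_between (X Y : pred T) v q : path e v q -> X v -> Y (last v q) ->
  exists v' q', [/\ ipath (v' :: q'), {subset v' :: q' <= v :: q}, X v' /\ Y (last v' q'),
    all (predC X) q' & all (predC Y) (belast v' q')].
Proof.
move=> pq Xv /(ipath_to pq) [q' [ip sub Yl nY]].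
have [|s1 [z [s2 [E Xz nX]]]] := @last_split X (v :: q'); first by rewrite /= Xv.
have [El Eb] := last_suffix E.
exists z, s2; rewrite -El; split=> //.
- by move: ip; rewrite E => /ipath_catr.
- by move=> t ts; apply: sub; rewrite E mem_cat ts orbT.
by apply/allP => t /Eb; apply: (allP nY).
Qed.

Lemma ipath_path x s : ipath (x :: s) -> path e x s.
Proof.
by elim: s x => // y s IH x; rewrite ipath_cons2 /= => /and3P [-> _ /IH].
Qed.

(** The walk is shortened twice. First, an induced path meeting [A] and [B] only in its ends;
    deleting these ends leaves a path outside both. Second, a subpath where only the first vertex
    has neighbors in [A] and only the last has neighbors in [B]: a crossing. *)
Lemma no_crossing_path a A b B c d (U : pred T) u p :
  theta_free e -> prism_free e -> tripod a A b B c d ->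
  (forall z, U z -> [&& apart a z, apart b z, apart c z & apart d z]) ->
  (forall z y, U z -> y \in A ++ B -> e d y -> apart z y) ->
  path e u p -> all U (u :: p) -> u \in A -> last u p \in B -> False.
Proof.
move=> TF PF tr UZ Ud pp Up uA lB.
have dAB : allrel apart A B by case: tr.
have [v1 [q1 [ip1 sub1 [v1A l1B] q1A q1B]]] :=
  @ipath_between (fun z => z \in A) (fun z => z \in B) u p pp uA lB.
(* Deleting both ends leaves a vertex: length zero would put a vertex in both [A] and [B], and
   length one would give an edge between them. *)
case: (lastP q1) => [|Q w1] in ip1 sub1 l1B q1A q1B *.
  by have := allrelP dAB _ _ v1A l1B; rewrite /apart eqxx.
rewrite last_rcons in l1B; rewrite belast_rcons in q1B.
case: Q => [|v2 q2] in ip1 sub1 q1A q1B *.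
  by have /andP [_] := allrelP dAB _ _ v1A l1B; have /andP [/= ->] := ipath_path ip1.
have := ipath_path ip1; rewrite rcons_cons /= rcons_path => /and3P [e12 p2 e2].
have hX : has (e v2) A by apply/hasP; exists v1 => //; rewrite e_sym.
have hY : has (e (last v2 q2)) B by apply/hasP; exists w1.
have [v [q [ip sub [Xv Yw] nX nY]]] :=
  @ipath_between (fun z => has (e z) A) (fun z => has (e z) B) v2 q2 p2 hX hY.
have {sub1}U2 z : z \in v2 :: q2 -> [/\ U z, z \notin A & z \notin B].
  move=> zQ; split.
  - by apply: (allP Up); apply: sub1; rewrite in_cons mem_rcons in_cons zQ !orbT.
  - by apply: (allP q1A); rewrite mem_rcons in_cons zQ orbT.
  by apply: (allP q1B); rewrite in_cons zQ orbT.
have vq := lastI v q.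
have {}U2 z : z \in v :: q -> [/\ U z, z \notin A & z \notin B] by move/sub/U2.
have vin : v \in v :: q by rewrite mem_head.
have win : last v q \in v :: q by rewrite mem_last.
have far z C : z \notin C -> ~~ has (e z) C -> all (apart z) C.
  move=> zC nC; apply/allP => t tC; apply/andP; split; first by apply: contraNneq zC => ->.
  by apply: contra nC => zt; apply/hasP; exists t.
have farr s C : {in s, forall z, z \notin C} ->
    all (predC (fun z => has (e z) C)) s -> allrel apart s C.
  by move=> sC /allP nC; apply/allP => z zs; apply: far; [apply: sC | apply: nC].
(* A vertex of the walk is apart from each neighbor of [d] on the hole, so its own neighbors in [A]
   and [B] are not adjacent to [d]. *)
have near z y : U z -> y \in A ++ B -> e z y -> apart y d.
  move=> Uz yAB zy; have /and4P [_ _ _ /andP [_ dz]] := UZ z Uz.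
  apply/andP; split; first by apply: contraNneq dz => <-; rewrite e_sym.
  by apply/negP; rewrite e_sym => /(Ud z y Uz yAB) /andP [_]; rewrite zy.
apply: (@no_crossing a A b B c d v q (belast v q) (last v q) TF PF); split=> //.
- by apply/allP => z /U2 [/UZ /and4P []].
- by apply/allP => z /U2 [/UZ /and4P []].
- by apply/allP => z /U2 [/UZ /and4P []].
- by apply/allP => z /U2 [/UZ /and4P []].
- by apply: farr => // z zq; have [|//] := U2 z; rewrite in_cons zq orbT.
- by apply: farr => // z zq; have [|//] := U2 z; rewrite vq mem_rcons in_cons zq orbT.
- by case: (U2 _ vin).
- by case: (U2 _ win).
- by move=> z zA; apply: near; [case: (U2 _ vin) | rewrite mem_cat zA].
by move=> z zB; apply: near; [case: (U2 _ win) | rewrite mem_cat zB orbT].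
Qed.

(** * From a special wheel to a tripod *)

Lemma icycle_rev x p : icycle x p -> icycle x (rev p).
Proof.
case/and4P=> xp ip sz /allP H; apply/and4P; split; rewrite ?mem_rev ?ipath_rev ?size_rev //.
have E : head x (rev p) = last x p /\ last x (rev p) = head x p.
  case: (p) => // y s; split; last by rewrite rev_cons last_rcons.
  by rewrite lastI rev_rcons last_rcons.
by case: E => -> ->; rewrite all_rev; apply/allP => v /H; rewrite orbC.
Qed.

Lemma hole_icycle H a b : hole e H -> a \in H -> b \in H -> e a b ->
  exists p, H = [set z in a :: rcons p b] /\ icycle a (rcons p b).
Proof.
case=> h [-> U sz C]; rewrite !in_set => ah bh ab.
have [i p E] := rot_to ah.
have mh : h =i a :: p by move=> z; rewrite -E mem_rot.
have icp : icycle a p.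
  apply/next_rel_icycle; rewrite -?E ?rot_uniq //.
    by have := size_rot i h; rewrite E /= => E1; rewrite -ltnS E1.
  by move=> u v; rewrite !mem_rot => uh vh; rewrite !next_rot //; apply: C.
have bp : b \in p.
  by move: bh; rewrite mh in_cons => /orP [/eqP E1|//]; rewrite E1 e_irr in ab.
suff [q [qp icq bq]] : exists q, [/\ q =i p, icycle a q & b = last a q].
  case: (lastP q) icq bq qp => [/and4P []//|q' b'] icq; rewrite last_rcons => -> qp.
  by exists q'; split=> //; apply/setP => z; rewrite !in_set mh !in_cons qp.
(* As a neighbor of [a], the vertex [b] is the first or the last of [p]; if it is the first, the
   cycle is reversed. *)
have /and4P [_ _ sp /allP /(_ b bp)] := icp; rewrite ab => /eqP /esym /orP [] /eqP E1.
  exists (rev p); split=> //; [exact: mem_rev | exact: icycle_rev |].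
  by rewrite E1; case: (p) sp => // y s _; rewrite rev_cons last_rcons.
by exists p.
Qed.

(** Dropping at least the last vertex removes the second neighbor of [x], leaving only the head of
    [s]. *)
Lemma icycle_prefix x s y t : icycle x (s ++ y :: t) -> ipath (x :: s).
Proof.
case: s => // z s /and4P [xs ip _ /allP H].
have U := ipath_uniq ip; rewrite cat_uniq in U.
have {}H v : v \in z :: s -> e x v = (v == z).
  move=> vs; rewrite (eqP (H v _)) ?mem_cat ?vs // last_cat /=.
  case: (eqVneq v (last y t)) => [E|]; last by rewrite orbF.
  by case/and3P: U => _ /hasP []; exists v => //; rewrite E mem_last.
rewrite ipath_cons2 H ?mem_head // eqxx; apply/andP; split=> //.
move: ip; rewrite ipath_cat => /andP [ips _]; apply/andP; split; last first.
  by move: ips; rewrite -ipath_rev rev_rcons => /ipath_cons; rewrite ipath_rev.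
apply/allP => v vs; rewrite /apart H ?in_cons ?vs ?orbT //; apply/andP; split.
  by apply: contraNneq xs => ->; rewrite mem_cat in_cons vs orbT.
by case/and3P: U => /andP [zs _] _ _; apply: contraNneq zs => <-.
Qed.

(** Neighbors of [x] are the first and last vertices of the cut cycle. The last is [z], and the
    first comes no later than [y], so neither is in [t]. *)
Lemma icycle_middle x s y t z : icycle x (rcons (s ++ y :: t) z) -> all (apart x) t.
Proof.
case/and4P=> xs /ipath_uniq U _ /allP H; apply/allP => v vt.
have vin : v \in rcons (s ++ y :: t) z by rewrite mem_rcons !(in_cons, mem_cat) vt !orbT.
apply/andP; split; first by apply: contraNneq xs => ->.
rewrite (eqP (H v vin)) last_rcons negb_or.
move: U; rewrite rcons_uniq cat_uniq cons_uniq => /and4P [nz _ /hasPn ns /andP [yt _]].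
apply/andP; split; last by apply: contraNneq nz => <-; rewrite mem_cat in_cons vt !orbT.
case: s ns {H vin xs nz} => [|u s] /= ns; first by apply: contraNneq yt => <-.
by apply/negP => /eqP E; have := ns v; rewrite in_cons vt orbT E mem_head => /(_ isT).
Qed.

Lemma ipath_sector H c x s y : {subset x :: s ++ [:: y] <= H} ->
  ipath (x :: s ++ [:: y]) -> e c x && e c y -> all (apart c) s ->
  sector e H c [set z in x :: s ++ [:: y]].
Proof.
move=> sH ip cxy /allP cs; exists x, y; split=> //.
- by apply/subsetP => z; rewrite in_set => /sH.
- by have := ipath_induced ip; rewrite last_cat.
- by rewrite path_length_seq ?(ipath_uniq ip) // size_cat addn1.
move=> z; rewrite in_setD in_set2 negb_or in_set in_cons mem_cat mem_seq1.
case: (z == x) => //=; case: (z == y); rewrite //= orbF => zs.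
by case/andP: (cs z zs).
Qed.

(** The short sector is given only as a set; this recovers the edge [a b] and that its ends are [a]
    and [b], in some order. *)
Lemma sector_pair a b x y :
  a != b -> induced_path e [set a; b] x y -> 0 < path_length [set a; b] ->
  e a b /\ [set a; b] = [set x; y].
Proof.
move=> nab [p [E lp U C]]; rewrite /path_length cards2 nab => _.
have sz : size (x :: p) = 2 by rewrite -(card_uniqP U) -cardsE -E cards2 nab.
case: p sz E lp U C => [//|z [|//]] /= _ E lp U C; rewrite -lp.
have Es : [set a; b] = [set x; z] by rewrite E; apply/setP => t; rewrite !inE.
have zx : (x == z) = false by move: U; rewrite inE andbT => /negbTE.
split=> //; have [xz zz] : e x z /\ e z x.
  by split; rewrite C ?inE ?eqxx ?orbT //= zx eqxx.
have aS : a \in [set x; z] by rewrite -Es set21.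
have bS : b \in [set x; z] by rewrite -Es set22.
move: aS bS nab; rewrite !in_set2.
by case/orP => /eqP ->; case/orP => /eqP ->; rewrite ?eqxx.
Qed.

(** Open the hole at the edge [a b] and walk from [a] to the first neighbor [n1] of [c]. Another
    neighbor of [c] before [b] would create too many sectors, so [n1] is [d] and it cuts the hole
    into the two long sectors. *)
Lemma special_wheel_tripod H S1 S2 c a b d :
  special_wheel e H c a b S1 S2 -> d \in H :\: [set a; b] -> e c d ->
  exists A B, [/\ tripod a A b B c d, {subset d :: A ++ B <= H} &
    forall S, sector e H c S ->
      S \in [:: [set a; b]; [set z in a :: A ++ [:: d]]; [set z in b :: B ++ [:: d]]]].
Proof.
case=> [[hH cH _] US secP len _] dH cd.
have /secP [x [y [sH ip l0 cxy _]]] : [set a; b] \in [:: [set a; b]; S1; S2] by rewrite mem_head.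
have nab : a != b by move: len; rewrite /path_length cards2; case: (a == b).
have [ab Exy] := sector_pair nab ip l0.
have {cxy ip x y Exy l0} [ca cb] : e c a /\ e c b.
  have h z : z \in [set a; b] -> e c z.
    by case/andP: cxy => cx cy; rewrite Exy in_set2 => /orP [] /eqP ->.
  by split; apply: h; rewrite in_set2 eqxx ?orbT.
have aH : a \in H by apply: (subsetP sH); rewrite set21.
have bH : b \in H by apply: (subsetP sH); rewrite set22.
have [p [EH icp]] := hole_icycle hH aH bH ab.
have mH : H =i a :: rcons p b by move=> z; rewrite EH in_set.
have cp : c \notin p by apply: contra cH => cp; rewrite mH in_cons mem_rcons in_cons cp !orbT.
have dp : d \in p.
  move: dH; rewrite in_setD in_set2 negb_or mH in_cons mem_rcons in_cons.
  by case: (d == a); case: (d == b).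
have pH z : z \in p -> z \in H by move=> zp; rewrite mH in_cons mem_rcons in_cons zp !orbT.
have := icycle_uniq icp; rewrite cons_uniq => /andP [ap Up].
have ipp : ipath (rcons p b) by case/and4P: icp.
have [|P1 [n1 [P2 [Ep cn1 cP1]]]] := @first_neighbor c p cp; first by apply/hasP; exists d.
have ipP1 : ipath (a :: P1 ++ [:: n1]).
  move: icp; rewrite Ep -[_ :: P2]/([:: n1] ++ P2) catA -cats1 -catA.
  (* The vertex after [n1] that [icycle_prefix] asks for is the head of [P2], or [b] if [P2] is
     empty. *)
  by case: P2 {Ep} => [|z t]; apply: icycle_prefix.
have nap z : z \in p -> (z == a) = false.
  by move=> zp; apply: contraNF ap => /eqP <-; rewrite mem_rcons in_cons zp orbT.
have nbp z : z \in p -> (z == b) = false.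
  by move=> zp; apply: contraTF Up => /eqP <-; rewrite rcons_uniq zp.
have sec1 : sector e H c [set z in a :: P1 ++ [:: n1]].
  apply: ipath_sector => //; last by rewrite ca.
  move=> z; rewrite in_cons mem_cat mem_seq1 => /or3P [/eqP -> //|zP|/eqP ->]; apply: pH;
  by rewrite Ep mem_cat ?zP // mem_head orbT.
have inS s z x y : (z \in [set t in x :: s ++ [:: y]]) = [|| z == x, z \in s | z == y].
  by rewrite in_set in_cons mem_cat mem_seq1.
have P2pH n Q1 Q2 : P2 = Q1 ++ n :: Q2 -> {subset b :: rev Q2 ++ [:: n] <= H}.
  move=> E z; rewrite in_cons mem_cat mem_rev mem_seq1 => /or3P [/eqP -> //|zP|/eqP ->]; apply: pH;
  by rewrite Ep E !(mem_cat, in_cons) ?zP ?eqxx !orbT.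
case hP2: (has (e c) P2).
  have cP2 : c \notin P2 by apply: contra cp; rewrite Ep mem_cat in_cons => ->; rewrite !orbT.
  (* A neighbor of c beyond n1 would give a fourth sector. *)
  have [Q3 [n2 [Q4 [E2 cn2 cQ4]]]] := last_neighbor cP2 hP2.
  have [Q1 [n3 [Q2 [E3 cn3 cQ1]]]] := first_neighbor cP2 hP2.
  have sec2 : sector e H c [set z in b :: rev Q4 ++ [:: n2]].
    apply: ipath_sector; rewrite ?all_rev ?cb //; first exact: P2pH E2.
    move: ipp; rewrite Ep E2 -[n1 :: _]cat_cons catA rcons_cat rcons_cons.
    by move/ipath_catr; rewrite cats1 -rev_cons -rev_rcons ipath_rev.
  have sec3 : sector e H c [set z in n1 :: Q1 ++ [:: n3]].
    apply: ipath_sector; rewrite ?cn1 //.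
      move=> z; rewrite in_cons mem_cat mem_seq1 => h; apply: pH; rewrite Ep E3.
      by rewrite !(mem_cat, in_cons); case/or3P: h => ->; rewrite ?orbT.
    move: ipp; rewrite Ep E3 rcons_cat => /ipath_catr.
    rewrite rcons_cons rcons_cat rcons_cons -cat_cons ipath_cat => /andP [].
    by rewrite -cats1.
  have n1p : n1 \in p by rewrite Ep mem_cat mem_head orbT.
  have n2p : n2 \in p by rewrite Ep E2 !(mem_cat, in_cons) eqxx !orbT.
  have n3p : n3 \in p by rewrite Ep E3 !(mem_cat, in_cons) eqxx !orbT.
  have inp s1 s2 s : p = s1 ++ s ++ s2 -> a \notin s /\ b \notin s.
    move=> E; have sp z : z \in s -> z \in p by rewrite E !mem_cat => ->; rewrite orbT.
    by split; apply/negP => /sp zp; [have := nap _ zp | have := nbp _ zp]; rewrite eqxx.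
  have [aP1 bP1] := inp [::] (n1 :: P2) P1 Ep.
  have [aQ4 bQ4] : a \notin Q4 /\ b \notin Q4.
    by apply: (inp (P1 ++ n1 :: Q3 ++ [:: n2]) [::]); rewrite Ep E2 cats0 -catA /= -catA.
  have [aQ1 bQ1] : a \notin Q1 /\ b \notin Q1.
    by apply: (inp (P1 ++ [:: n1]) (n3 :: Q2)); rewrite Ep E3 -catA.
  (* The four sectors contain both of [a] and [b], only [a], only [b], and neither, so they are
     pairwise distinct and do not fit in a list of three. *)
  have neq (X Y : {set T}) z : z \in X -> z \notin Y -> X != Y.
    by move=> zX; apply: contraNneq => <-.
  have [aX1 bX1] : a \in [set z in a :: P1 ++ [:: n1]] /\
      b \notin [set z in a :: P1 ++ [:: n1]].
    by rewrite !inS eqxx (negbTE bP1) [b == a]eq_sym (negbTE nab) [b == n1]eq_sym nbp.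
  have [bX2 aX2] : b \in [set z in b :: rev Q4 ++ [:: n2]] /\
      a \notin [set z in b :: rev Q4 ++ [:: n2]].
    by rewrite !inS eqxx !mem_rev (negbTE aQ4) (negbTE nab) [a == n2]eq_sym nap.
  have [aX3 bX3] : a \notin [set z in n1 :: Q1 ++ [:: n3]] /\
      b \notin [set z in n1 :: Q1 ++ [:: n3]].
    by rewrite !inS (negbTE aQ1) (negbTE bQ1) !(eq_sym a) !(eq_sym b) !nap ?nbp.
  suff: size [:: [set a; b]; [set z in a :: P1 ++ [:: n1]]; [set z in b :: rev Q4 ++ [:: n2]];
     [set z in n1 :: Q1 ++ [:: n3]]] <= size [:: [set a; b]; S1; S2] by [].
  apply: uniq_leq_size; last first.
    move=> S; rewrite in_cons => /orP [/eqP ->|]; first by rewrite mem_head.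
    by rewrite !in_cons in_nil orbF => /or3P [] /eqP ->; apply/secP.
  have aS := set21 a b; have bS := set22 a b.
  rewrite !cons_uniq !in_cons !in_nil !orbF !negb_or.
  by rewrite (neq _ _ _ bS bX1) (neq _ _ _ aS aX2) (neq _ _ _ aS aX3) (neq _ _ _ aX1 aX2)
    (neq _ _ _ aX1 aX3) (neq _ _ _ bX2 bX3).
have cP2 : all (apart c) P2.
  apply/allP => z zP; apply/andP; split; last by apply: contraFN hP2 => cz; apply/hasP; exists z.
  by apply: contraNneq cp => ->; rewrite Ep mem_cat in_cons zP !orbT.
have dn : d = n1.
  move: dp; rewrite Ep mem_cat in_cons => /or3P [dP|/eqP //|dP].
    by have /andP [_] := allP cP1 _ dP; rewrite cd.
  by have /andP [_] := allP cP2 _ dP; rewrite cd.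
rewrite -{n1}dn in Ep cn1 ipP1 sec1 *.
have ipP2 : ipath (b :: rev P2 ++ [:: d]).
  move: ipp; rewrite Ep rcons_cat rcons_cons => /ipath_catr.
  by rewrite cats1 -rev_cons -rev_rcons ipath_rev.
have sec2 : sector e H c [set z in b :: rev P2 ++ [:: d]].
  apply: ipath_sector; rewrite ?all_rev ?cb //.
  move=> z; rewrite in_cons mem_cat mem_rev mem_seq1 => /or3P [/eqP -> //|zP|/eqP ->]; apply: pH;
  by rewrite Ep !(mem_cat, in_cons) ?zP ?eqxx !orbT.
have tr : tripod a P1 b (rev P2) c d.
  have := ipp; rewrite Ep rcons_cat rcons_cons ipath_cat => /and3P [_ hP].
  rewrite -cats1 allrel_catr allrel_apart_consr => /and3P [P12 bP1 _].
  split; rewrite ?all_rev ?allrel_revr //; last by rewrite ca cb cd.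
  by apply: (@icycle_middle a P1 d P2 b); rewrite -Ep.
exists P1, (rev P2); split=> //.
  move=> z; rewrite in_cons mem_cat mem_rev => zz; apply: pH; rewrite Ep.
  by rewrite mem_cat in_cons; case/or3P: zz => ->; rewrite ?orbT.
(* Three distinct sectors inside a list of three exhaust it, so every sector is one of them. *)
have := @uniq_min_size _ [:: [set a; b]; [set z in a :: P1 ++ [:: d]];
  [set z in b :: rev P2 ++ [:: d]]] [:: [set a; b]; S1; S2].
case=> //.
- rewrite !cons_uniq !in_cons !in_nil !orbF !negb_or.
  have bX1 : b \notin [set z in a :: P1 ++ [:: d]].
    rewrite inS [b == a]eq_sym (negbTE nab) [b == d]eq_sym nbp // orbF /=.
    by apply/negP => bP; have := nbp b; rewrite Ep mem_cat bP eqxx => /(_ isT).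
  have aX2 : a \notin [set z in b :: rev P2 ++ [:: d]].
    rewrite inS (negbTE nab) [a == d]eq_sym nap // orbF /= mem_rev.
    by apply/negP => aP; have := nap a; rewrite Ep mem_cat in_cons aP eqxx !orbT => /(_ isT).
  have neq (X Y : {set T}) z : z \in X -> z \notin Y -> X != Y.
    by move=> zX; apply: contraNneq => <-.
  rewrite (neq _ _ b (set22 _ _) bX1) (neq _ _ a (set21 _ _) aX2) /= andbT.
  by apply: (neq _ _ a _ aX2); rewrite inS eqxx.
- move=> S; rewrite in_cons => /orP [/eqP ->|]; first by rewrite mem_head.
  by rewrite !in_cons in_nil orbF => /orP [] /eqP ->; apply/secP.
by move=> _ E S /secP; rewrite E.
Qed.

(** * Separation as non-reachability, and conclusion *)

Lemma separates_connect (M : {set T}) x y : x \notin M -> y \notin M ->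
  ~~ connect (fun u v => e u v && (v \notin M)) x y -> separates e M x y.
Proof.
set e' := fun u v => _ => xM yM nxy; split=> //.
(* [e'] tests only the target of a step; since [x] is outside [M], all of [L] is. The other side is
   everything outside [L] and [M]. *)
pose L := [set z | connect e' x z].
have LM z : z \in L -> z \notin M.
  rewrite in_set => /connectP [p]; case: (lastP p) => [_ -> //|s w].
  by rewrite rcons_path last_rcons => /andP [_ /andP [_ wM]] ->.
exists L, (~: (L :|: M)).
have xL : x \in L by rewrite in_set connect0.
have yR : y \in ~: (L :|: M) by rewrite in_setC in_setU negb_or in_set nxy.
split=> //; split; first split.
- by rewrite disjoint_subset; apply/subsetP => z /LM.
- by rewrite disjoints_subset setCK subsetUl.
- by rewrite disjoints_subset setCK subsetUr.
- by rewrite setUCr.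
- by apply/set0Pn; exists x.
- by apply/set0Pn; exists y.
move=> u v uL; rewrite in_setC in_setU negb_or => /andP [vL vM].
apply: contra vL => uv; rewrite !in_set in uL *.
by apply: connect_trans uL (connect1 _); rewrite /e' uv.
Qed.

Lemma no_connect_across a A b B c d (M : {set T}) (x y : T) :
  theta_free e -> prism_free e -> tripod a A b B c d ->
  (forall z, z \notin M -> [&& apart a z, apart b z, apart c z & apart d z]) ->
  (forall z w, z \notin M -> w \in A ++ B -> e d w -> apart z w) ->
  x \notin M -> x \in A -> y \in B ->
  ~~ connect (fun u v => e u v && (v \notin M)) x y.
Proof.
move=> TF PF tr MZ Md xM xA yB; apply/negP => /connectP [p pp yp].
have [pe pM] : path e x p /\ all (fun z => z \notin M) p.
  by elim: p x pp {xM xA yp} => //= z p IH x /andP [/andP [-> ->] /IH].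
apply: (no_crossing_path TF PF tr MZ Md pe _ xA); last by rewrite -yp.
by rewrite /= xM.
Qed.

Lemma notin_cnbh (X : {set T}) x z : z \notin cnbh e X -> x \in X -> apart x z.
Proof.
rewrite in_set negb_or => /andP [zX /exists_inPn nz] xX.
by rewrite /apart e_sym nz // andbT; apply: contraNneq zX => <-.
Qed.

End InducedPaths.

Theorem theorem3p2 (T : finType) (e : rel T)
    (e_sym : symmetric e) (e_irr : irreflexive e)
    (G_theta_free : theta_free e) (G_prism_free : prism_free e)
    (H S1 S2 : {set T}) (c a b d : T)
    (W_special : special_wheel e H c a b S1 S2)
    (S1_ge3 : 3 <= path_length S1) (S2_ge3 : 3 <= path_length S2)
    (d_in_H : d \in H :\: [set a; b]) (d_adj_c : e c d)
    (a'' b'' : T)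
    (a''_notin : a'' \notin cnbh e (Zset e H c a b d))
    (b''_notin : b'' \notin cnbh e (Zset e H c a b d))
    (Sa Sb : {set T}) (xa ya xb yb : T)
    (Sa_sector : sector_with_ends e H c Sa xa ya)
    (Sb_sector : sector_with_ends e H c Sb xb yb)
    (Sa_neq_Sb : Sa != Sb)
    (a''_in : a'' \in interior Sa xa ya)
    (b''_in : b'' \in interior Sb xb yb) :
  separates e (cnbh e (Zset e H c a b d)) a'' b''.
Proof.
have [A [B [tr ABH sec]]] := special_wheel_tripod e_sym e_irr W_special d_in_H d_adj_c.
set M := cnbh _ _ in a''_notin b''_notin *.
have MZ z : z \notin M -> [&& apart e a z, apart e b z, apart e c z & apart e d z].
  move=> zM; have dH : d \in H by case/setDP: d_in_H.
  by apply/and4P; split; apply: (notin_cnbh e_sym zM);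
    rewrite !inE ?eqxx ?dH ?orbT.
have Md z t : z \notin M -> t \in A ++ B -> e d t -> apart e z t.
  move=> zM tAB dt; rewrite apartC //; apply: (notin_cnbh e_sym zM).
  have tH : t \in H by apply: ABH; rewrite in_cons tAB orbT.
  by rewrite /Zset in_setU orbC in_set tH dt orbT.
have cnt S x y z : sector_with_ends e H c S x y -> z \in interior S x y ->
    [/\ S \in [:: [set a; b]; [set z in a :: A ++ [:: d]]; [set z in b :: B ++ [:: d]]],
     z \in S & z \notin [set a; b; d]].
  move=> Sxy zS; split; first by apply: sec; exists x, y.
    by case/setDP: zS.
  (* Interior vertices of a sector are not adjacent to [c], whereas [a], [b] and [d] are. *)
  case: Sxy => _ _ _ _ /(_ z zS); case: tr => _ _ _ _ _ _ /and3P [ca cb cd] _ _.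
  by apply: contra; rewrite !inE -orbA => /or3P [] /eqP ->.
have inA z : z \in [set z in a :: A ++ [:: d]] -> z \notin [set a; b; d] -> z \in A.
  rewrite !inE mem_cat mem_seq1; case: (z == a) => //=; case: (z == d); rewrite ?orbT //.
  by rewrite orbF.
have inB z : z \in [set z in b :: B ++ [:: d]] -> z \notin [set a; b; d] -> z \in B.
  rewrite !inE mem_cat mem_seq1; case: (z == b); rewrite ?orbT //=.
  by case: (z == d); rewrite ?orbT ?orbF.
have inab z : z \in [set a; b] -> z \notin [set a; b; d] -> False.
  by rewrite !inE => ->.
have [Sal a''S a''n] := cnt _ _ _ _ Sa_sector a''_in.
have [Sbl b''S b''n] := cnt _ _ _ _ Sb_sector b''_in.
apply: separates_connect => //.
(* The short sector has no vertex outside [[set a; b; d]] and the two sectors differ, so [a''] and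
   [b''] lie in different long sectors. Two cases remain, exchanged by [tripodC]. *)
move: Sal Sbl; rewrite !inE => /or3P [] /eqP Ea /or3P [] /eqP Eb;
  rewrite Ea in a''S Sa_neq_Sb; rewrite Eb in b''S Sa_neq_Sb; rewrite ?eqxx // in Sa_neq_Sb;
  try (by case: (inab _ a''S)); try (by case: (inab _ b''S)).
- by apply: (no_connect_across e_sym e_irr G_theta_free G_prism_free tr MZ Md) => //; auto.
apply: (no_connect_across e_sym e_irr G_theta_free G_prism_free (tripodC e_sym tr)) => //; auto.
- by move=> z /MZ /and4P [-> -> -> ->].
by move=> z t zM tAB; apply: Md; rewrite // mem_cat orbC -mem_cat.
Qed.
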